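(* Let $c>0$, $0<\lambda<T_M$, and let $f\in C^2(\mathbb R)$ solve $$f''(y)-cf'(y)-f^4(y)=-\int_{-\infty}^\infty E(y-\eta)f^4(\eta)\,d\eta\ (y\in\mathbb R),\qquad 0<\lambda\le f\le T_M.$$ Then $f$ is constant.
   Context: $E(x)=\frac12\int_{|x|}^\infty\frac{e^{-t}}{t}dt$. *)

(* Defs.v *)
From mathcomp Require Import all_boot all_order all_algebra.
From mathcomp Require Import all_classical all_reals all_analysis.
Import Order.TTheory GRing.Theory Num.Theory.
Import numFieldNormedType.Exports.
Local Open Scope classical_set_scope.
Local Open Scope ring_scope.

(* E(x) = 1/2 * int_{|x|}^oo e^{-t}/t dt, as an extended real
   (it equals +oo at x = 0, a Lebesgue-null point). *)
Definition Ekernel (R : realType) (x : R) : \bar R :=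
  ((2^-1)%:E * \int[@lebesgue_measure R]_(t in [set t : R | (`|x| <= t)%R])
                  (expR (- t) / t)%:E)%E.

Definition Econv (R : realType) (f : R -> R) (y : R) : \bar R :=
  (\int[@lebesgue_measure R]_(eta in [set: R])
      (@Ekernel R (y - eta)%R * (f eta ^+ 4)%:E))%E.

(* Main.v *)
(* Write g = f^4, G' = g and P' = G. Exchanging the two integrals in E * g gives
     (E * g)(y) = int_0^oo e^(-t) A_t(y) dt,
   where A_t(y) = (G(y + t) - G(y - t)) / (2t) is the mean of g over [y - t, y + t].
   Hence the equation has the first integral f' - c f + J, with
     J(y) = int_0^oo e^(-t) ((P(y + t) - P(y - t)) / (2t) - G(y)) dt.
   Let M = sup f. Maximising f - d (. - y0)^2 with f(y0) > M - d produces a point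
   a where f is d-close to M, f' = O(d) and f'' <= O(d); the equation then forces
   int_0^oo e^(-t) (M^4 - A_t(a)) dt = O(d), and as the integrand is nonnegative
   this makes J(a) small. The same holds at a point b near inf f. Comparing the
   first integral at a and b and letting d -> 0 yields c (sup f - inf f) <= 0. *)

Require Import Defs.
From mathcomp Require Import all_boot all_order all_algebra.
From mathcomp Require Import all_classical all_reals all_analysis.
From mathcomp Require Import measurable_realfun ring lra.
Import Order.TTheory GRing.Theory Num.Theory.
Import numFieldNormedType.Exports.
Local Open Scope classical_set_scope.
Local Open Scope ring_scope.

(** * Primitives and mean values on the line *)

(** Integrals over [[a, x]] are unoriented, so the base point must lie to the left of both 0 and the
    argument. It therefore moves with [x]; by additivity it cancels in the difference, which near a
    given point equals [I a] minus a constant for one fixed [a]. *)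
Lemma ex_primitive (R : realType) (g : R -> R) :
  continuous g -> exists G : R -> R, forall x : R, is_derive x 1 G (g x).
Proof.
move=> cg.
have ig a b : (@lebesgue_measure R).-integrable `[a, b] (EFin \o g).
  apply: continuous_compact_integrable; first exact: segment_compact.
  exact: continuous_subspaceT.
pose I a x := (\int[@lebesgue_measure R]_(t in `[a, x]) g t)%R.
have chasles a b x : a <= b -> b <= x -> I a x - I a b = I b x.
  move=> ab bx; rewrite /I Rintegral_itvB ?bnd_simp//.
  rewrite Rintegral_itv_obnd_cbnd//.
  by apply: integrableS (ig b x) => //; apply: subset_itvr; rewrite bnd_simp.
exists (fun x => I (- `|x| - 1) x - I (- `|x| - 1) 0) => x.
pose a : R := - `|x| - 2.
have [dI I'] : derivable (I a) x 1 /\ derive1 (I a) x = g x.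
  apply: (@continuous_FTC1_closed _ _ a x (x + 1)) => //.
  - by rewrite ltrDl.
  - by have := ler_norm (- x); rewrite normrN /a; lra.
  - exact: cg.
have dIa : is_derive x 1 (I a) (g x).
  by apply: DeriveDef; [exact: dI|rewrite -derive1E].
apply: (@near_eq_is_derive _ _ _ (I a \- cst (I a 0))).
  near=> y.
  have xy : `|x - y| < 1.
    by near: y; apply/(@cvgr_dist_lt _ R^o _ _ _ id x cvg_id).
  have y1 : `|y| < `|x| + 1 by have := ler_distD x y 0; rewrite !subr0 distrC; lra.
  have b0 := normr_ge0 y; have by_ := ler_norm (- y); rewrite normrN in by_.
  rewrite /= -(chasles a (- `|y| - 1) y) -?(chasles a (- `|y| - 1) 0) /a; lra.
by have := is_deriveB dIa (is_derive_cst (I a 0) x 1); rewrite subr0.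
Unshelve. all: by end_near. Qed.

Lemma is_derive_continuous (R : realType) (f df : R -> R) :
  (forall x : R, is_derive x 1 f (df x)) -> continuous f.
Proof.
by move=> dxf x; apply/differentiable_continuous/derivable1_diffP/ex_derive.
Qed.

Lemma MVT_line (R : realType) (f df : R -> R) (a b : R) :
  (forall x : R, is_derive x 1 f (df x)) -> a < b ->
  exists2 c, a < c < b & f b - f a = df c * (b - a).
Proof.
move=> dxf ab.
have dab x : x \in `]a, b[ -> is_derive x 1 f (df x) by move=> _; exact: dxf.
have cab : {within `[a, b], continuous f}.
  by apply: continuous_subspaceT; exact: is_derive_continuous dxf.
by have [c] := MVT ab dab cab; rewrite in_itv/=; exists c.
Qed.

(** * Points of approximate maximum *)

(** If [k] were positive then, as [df c = 0], [df] would be positive just to the right of [c], and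
    the mean value theorem would make [f] exceed [f c] there. *)
Lemma second_derivative_at_max (R : realType) (f df : R -> R) (a b c k : R) :
  (forall x : R, is_derive x 1 f (df x)) -> a < c < b ->
  (forall t, a < t < b -> f t <= f c) -> is_derive c 1 df k ->
  df c = 0 /\ k <= 0.
Proof.
move=> dxf acb fmax dk; have /andP[ac cb] := acb.
have dfc0 : df c = 0.
  have d0 : is_derive c 1 f 0.
    apply: (@derive1_at_max R f a b c (ltW (lt_trans ac cb))).
    - by move=> t _; exact: ex_derive.
    - by rewrite in_itv.
    - by move=> t; rewrite in_itv/=; exact: fmax.
  by rewrite -(@derive_val _ _ _ _ _ _ _ (dxf c)) derive_val.
split=> //; rewrite leNgt; apply/negP => k0.
have [ddf dfk] := dk.
have cv : h^-1 *: (df (h *: 1 + c) - df c) @[h --> 0^'+] --> k.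
  by apply: cvg_dnbhs_at_right; rewrite -dfk; exact: ddf.
have [e /= e0 dfe] := cvgr_gt _ cv _ k0.
(* The first bound keeps the mean value point where the difference quotient of [df] is positive, the
   second keeps [c + r] below [b]. *)
pose r := Num.min (e / 2) ((b - c) / 2).
have r0 : 0 < r by rewrite /r lt_min; apply/andP; split; lra.
have re : r <= e / 2 by rewrite /r ge_min lexx.
have rb : r <= (b - c) / 2 by rewrite /r ge_min lexx orbT.
have [|x /andP[cx xr] fr] := @MVT_line R f df c (c + r) dxf; first lra.
have : 0 < df x.
  have := dfe (x - c); rewrite /= sub0r normrN gtr0_norm ?subr_gt0//.
  rewrite dfc0 subr0 [_ *: 1]mulr1 subrK => /(_ ltac:(lra) cx).
  by rewrite pmulr_rgt0// invr_gt0 subr_gt0.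
have := fmax (c + r); have : a < c + r < b by apply/andP; split; lra.
move=> -> /(_ isT) fc dfx.
have : 0 < df x * (c + r - c) by rewrite mulr_gt0//; lra.
lra.
Qed.

Lemma approximate_max (R : realType) (f df ddf : R -> R) (M d : R) :
  (forall x : R, is_derive x 1 f (df x)) ->
  (forall x : R, is_derive x 1 df (ddf x)) ->
  (forall x, f x <= M) -> 0 < d -> (exists y, M - d < f y) ->
  exists a, [/\ M - d < f a, `|df a| <= 2 * d & ddf a <= 2 * d].
Proof.
move=> df1 df2 fM d0 [y fy].
pose h (x : R) := f x - d * (x - y) ^+ 2.
pose dh (x : R) := df x - 2 * d * (x - y).
have dxh (x : R) : is_derive x 1 h (dh x).
  by apply: is_derive_eq; rewrite /dh /GRing.scale/=; ring.
have ddh (x : R) : is_derive x 1 dh (ddf x - 2 * d).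
  by apply: is_derive_eq; rewrite /GRing.scale/=; ring.
(* Any radius above 1 would do: [h a >= h y > M - d] forces [|a - y| < 1], so the maximiser is
   interior. *)
have [a a2 ha] : exists2 a, a \in `[y - 2, y + 2] &
    forall t, t \in `[y - 2, y + 2] -> h t <= h a.
  apply: EVT_max; first lra.
  by apply: continuous_subspaceT; exact: is_derive_continuous dxh.
have hya : h y <= h a by apply: ha; rewrite in_itv/=; apply/andP; split; lra.
have day : d * (a - y) ^+ 2 < d.
  by have := fM a; move: hya; rewrite /h subrr expr0n/= mulr0; lra.
have ay : (a - y) ^+ 2 < 1 by rewrite -(ltr_pM2l d0) mulr1.
have ay1 : `|a - y| < 1.
  by rewrite -(@ltr_pXn2r _ 2) ?nnegrE// -normrX expr1n ger0_norm ?sqr_ge0.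
have /andP[ay2 ay3] : -1 < a - y < 1 by rewrite -ltr_norml.
have aI : y - 2 < a < y + 2 by apply/andP; split; lra.
have hmax t : y - 2 < t < y + 2 -> h t <= h a.
  by move=> /andP[? ?]; apply: ha; rewrite in_itv/=; apply/andP; split; lra.
have [dha0 ddha0] := second_derivative_at_max _ _ _ _ _ _ _ dxh aI hmax (ddh a).
exists a; split.
- have := mulr_ge0 (ltW d0) (sqr_ge0 (a - y)).
  by move: hya; rewrite /h subrr expr0n/= mulr0; lra.
- have -> : df a = 2 * d * (a - y) by move: dha0; rewrite /dh; lra.
  by rewrite normrM ger0_norm; [rewrite ler_piMr//; lra|lra].
- lra.
Qed.

(** * Centered means of a primitive *)

(** Subtracting [K * x] from [G] changes neither side, since the centered mean of [K * x] is
    [K * y], and it makes the remainder [H] monotone. The mean of [H] is a value [H z]; both [H z]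
    and [H y] lie between the values of [H] at the two ends, so they differ by at most its total
    increment. *)
Lemma centered_mean_bound (R : realType) (g G P : R -> R) (K y t : R) :
  (forall x : R, is_derive x 1 G (g x)) ->
  (forall x : R, is_derive x 1 P (G x)) ->
  (forall x, g x <= K) \/ (forall x, K <= g x) -> 0 < t ->
  `|(P (y + t) - P (y - t)) / (2 * t) - G y| <=
  `|K * (2 * t) - (G (y + t) - G (y - t))|.
Proof.
move=> dG dP gK t0.
pose H (x : R) := G x - K * x.
pose Q (x : R) := P x - K / 2 * x ^+ 2.
have dH (x : R) : is_derive x 1 H (g x - K).
  by apply: is_derive_eq; rewrite /GRing.scale/=; ring.
have dQ (x : R) : is_derive x 1 Q (H x).
  by apply: is_derive_eq; rewrite /H /GRing.scale/=; field.
have [|z /andP[z1 z2] Qz] := MVT_line _ _ _ (y - t) (y + t) dQ; first lra.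
have -> : (P (y + t) - P (y - t)) / (2 * t) - G y = H z - H y.
  have -> : P (y + t) - P (y - t) = (H z + K * y) * (2 * t).
    move: Qz; rewrite /Q => Qz.
    have -> : P (y + t) - P (y - t) = (P (y + t) - K / 2 * (y + t) ^+ 2 -
      (P (y - t) - K / 2 * (y - t) ^+ 2)) + K * y * (2 * t) by field.
    by rewrite Qz; ring.
  by rewrite mulfK; [rewrite /H; ring|lra].
have -> : K * (2 * t) - (G (y + t) - G (y - t)) = - (H (y + t) - H (y - t)).
  by rewrite /H; ring.
rewrite normrN.
(* The truth value of [K <= g] fixes the sign of every increment of [H], so that both monotonicity
   cases run through the same four inequalities. *)
have incr a b : a <= b -> exists2 c, 0 <= c &
    H b - H a = (if `[<forall x, K <= g x>] then c else - c).
  rewrite le_eqVlt => /predU1P[->|ab].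
    by exists 0 => //; rewrite subrr oppr0 if_same.
  have [c _ ->] := MVT_line _ _ _ a b dH ab.
  case: asboolP => gK'.
    by exists ((g c - K) * (b - a)) => //; rewrite mulr_ge0// subr_ge0// ltW.
  exists ((K - g c) * (b - a)); last ring.
  by case: gK => // gK; apply: mulr_ge0; rewrite subr_ge0 ?(ltW ab).
have [c1 c10 H1] := incr (y - t) y ltac:(lra).
have [c2 c20 H2] := incr y (y + t) ltac:(lra).
have [c3 c30 H3] := incr (y - t) z (ltW z1).
have [c4 c40 H4] := incr z (y + t) (ltW z2).
rewrite (_ : H (y + t) - H (y - t) = (H (y + t) - H y) + (H y - H (y - t))); last ring.
by move: H1 H2 H3 H4; case: ifP => _ H1 H2 H3 H4;
  [rewrite [leRHS]ger0_norm|rewrite [leRHS]ler0_norm]; try lra;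
  rewrite ler_norml; apply/andP; split; lra.
Qed.

(** * Integrals with exponential weight *)

Lemma measurable_invr (R : realType) (D : set R) : measurable D ->
  measurable_fun D (@GRing.inv R).
Proof.
move=> mD; apply: (@measurable_funS _ _ _ _ setT) => //.
rewrite -(setvU [set 0 : R]); apply/measurable_funU => //.
  exact: measurableC.
split; last exact: measurable_fun_set1.
apply: open_continuous_measurable_fun.
  by apply: closed_openC; exact: closed_eq.
by move=> x /set_mem/= /eqP x0; exact: inv_continuous.
Qed.

Lemma integral_expRN (R : realType) (r : R) : 0 < r ->
  (\int[@lebesgue_measure R]_(t in `]0%R, +oo[) (expR (- (r * t)))%:E = r^-1%:E)%E.
Proof.
move=> r0.
have cE : continuous (fun t : R => expR (- (r * t))).
  by apply: (@is_derive_continuous R _ (fun t => - r * expR (- (r * t)))) => x;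
    apply: is_derive_eq; rewrite /GRing.scale/=; ring.
rewrite integral_itv_obnd_cbnd; last first.
  by apply/measurable_EFinP; apply: measurable_funTS; exact: continuous_measurable_fun.
(* The value comes from the unit mass of the exponential law of rate [r]. *)
have := integral_exponential_pdf r0.
have -> : (fun x => (exponential_pdf r x)%:E) =
    (fun t => (r%:E * (expR (- (r * t)))%:E)%E) \_ `[0, +oo[.
  by apply/funext => x; rewrite /exponential_pdf !patchE; case: ifP => // _;
    rewrite mulNr EFinM.
rewrite -integral_mkcond.
rewrite ge0_integralZl_EFin//.
- move=> I1; rewrite -[LHS]mul1e -[in LHS](@mulVf _ r) ?gt_eqF// EFinM -muleA.
  by rewrite I1 mule1.
- by apply/measurable_EFinP; apply: measurable_funTS; exact: continuous_measurable_fun.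
- exact: ltW.
Qed.

Lemma integrable_expRN (R : realType) (r : R) : 0 < r ->
  (@lebesgue_measure R).-integrable `]0, +oo[ (EFin \o (fun t => expR (- (r * t)))).
Proof.
move=> r0; apply/integrableP; split.
  apply/measurable_EFinP; apply: measurable_funTS; apply: continuous_measurable_fun.
  by apply: (@is_derive_continuous R _ (fun t => - r * expR (- (r * t)))) => x;
    apply: is_derive_eq; rewrite /GRing.scale/=; ring.
under eq_integral do rewrite /= ger0_norm ?expR_ge0//.
by rewrite integral_expRN// ltry.
Qed.

(* [t <= 4 * expR (t / 4)], hence [t^2 expR (-t) <= 16 expR (-t/2)]. *)
Lemma integrable_quadratic_expRN (R : realType) (h : R -> R) (C : R) :
  measurable_fun (`]0, +oo[ : set R) h ->
  (forall t, 0 < t -> `|h t| <= C * (1 + t ^+ 2)) ->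
  (@lebesgue_measure R).-integrable `]0, +oo[ (EFin \o (fun t => expR (- t) * h t)).
Proof.
move=> mh hC.
have i2 : (0 : R) < 2^-1 by lra.
have /(integrableZl _ (17 * C)) : (@lebesgue_measure R).-integrable `]0, +oo[
    (EFin \o (fun t => expR (- (2^-1 * t)))).
  exact: integrable_expRN.
move=> /(_ ltac:(exact: measurable_itv)).
apply: le_integrable => //.
  apply/measurable_EFinP; apply: measurable_funM => //.
  by apply: measurableT_comp => //; exact: measurable_funN.
move=> t /=; rewrite in_itv/= andbT => t0.
rewrite lee_fin.
have C0 : 0 <= C.
  by have := le_trans (normr_ge0 _) (hC _ t0); rewrite pmulr_lge0//; nra.
have e4 : t <= 4 * expR (t / 4) by have := expR_ge1Dx (t / 4); lra.
rewrite normrM ger0_norm ?expR_ge0//.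
rewrite [leRHS]ger0_norm ?mulr_ge0 ?expR_ge0//.
have -> : expR (- (2^-1 * t)) = expR (- t) * expR (t / 4) ^+ 2.
  by rewrite -expRM_natl -expRD; congr expR; field.
rewrite mulrCA; apply: ler_wpM2l; first exact: expR_ge0.
apply: le_trans (hC _ t0) _; rewrite [17 * C]mulrC -mulrA; apply: ler_wpM2l => //.
have : 1 <= expR (t / 4) by have := expR_ge1Dx (t / 4); lra.
nra.
Qed.

(** * The convolution as an average of means *)

(** Tonelli on the region [|y - eta| <= t]: its slice at fixed [t > 0] is [[y - t, y + t]], where
    [g] integrates to an increment of [G]. Nonnegativity suffices, so the identity holds in the
    extended reals before finiteness is known. *)
Lemma Econv_mean (R : realType) (f G : R -> R) (y : R) :
  continuous f -> (forall x : R, is_derive x 1 G (f x ^+ 4)) ->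
  Econv R f y = (\int[@lebesgue_measure R]_(t in `]0%R, +oo[)
    (expR (- t) * ((G (y + t) - G (y - t)) / (2 * t)))%:E)%E.
Proof.
move=> cf dG.
pose g x := f x ^+ 4.
have cg : continuous g.
  move=> x; apply: (@continuous_comp _ _ _ f (fun z : R => z ^+ 4)).
    exact: cf.
  exact: exprn_continuous.
have g0 x : 0 <= g x by rewrite /g exprn_even_ge0.
have mg : measurable_fun setT g by exact: continuous_measurable_fun.
have mEt : measurable_fun setT (fun t : R => expR (- t) / t).
  apply: measurable_funM; last exact: measurable_invr.
  by apply: measurableT_comp => //; exact: measurable_funN.
pose S := [set p : measurableTypeR R * measurableTypeR R | `|y - p.1| <= p.2].
have mS : measurable S.
  rewrite -[S]setTI; apply: measurable_fun_le => //.
  apply: measurableT_comp => //; apply: measurable_funB => //.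
pose k (p : measurableTypeR R * measurableTypeR R) : \bar R :=
  ((2^-1 * g p.1 * (expR (- p.2) / p.2)) * \1_S p)%:E.
have mk : measurable_fun setT k.
  apply/measurable_EFinP; apply: measurable_funM; last exact: measurable_indic.
  apply: measurable_funM.
    apply: measurable_funM => //.
    exact: (measurableT_comp mg).
  exact: (measurableT_comp mEt).
(* [expR (- t) / t] is negative for [t < 0], but membership in [S] forces [t >= 0]. *)
have k0 p : (0 <= k p)%E.
  rewrite /k lee_fin indicE; case: (boolP (p \in S)) => [|_]; last by rewrite mulr0.
  rewrite inE => pS; have p2 : 0 <= p.2 by exact: le_trans pS.
  rewrite mulr1; apply: mulr_ge0; first by apply: mulr_ge0 => //; rewrite invr_ge0.
  by apply: mulr_ge0; rewrite ?invr_ge0// expR_ge0.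
rewrite /Econv.
transitivity (\int[@lebesgue_measure R]_x \int[@lebesgue_measure R]_t k (x, t))%E.
  apply: eq_integral => x _.
  pose D := [set t : R | `|y - x| <= t].
  have DE : D = `[`|y - x|, +oo[%classic.
    by apply/seteqP; split=> t; rewrite /D /= in_itv/= andbT.
  have mD : measurable D by rewrite DE; exact: measurable_itv.
  rewrite /Ekernel -/D -/(g x) muleAC -EFinM -ge0_integralZl_EFin//.
  - rewrite integral_mkcond; apply: eq_integral => t _.
    rewrite patchE /k indicE/=.
    have -> : ((x, t) \in S) = (t \in D) by apply/idP/idP; rewrite !inE.
    by case: ifP => _; rewrite ?mulr1 ?mulr0// -EFinM.
  - by move=> t /= Dt; rewrite lee_fin mulr_ge0 ?expR_ge0// invr_ge0 (le_trans _ Dt).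
  - by apply/measurable_EFinP; exact: measurable_funTS.
  - by rewrite mulr_ge0.
rewrite fubini_tonelli// [RHS]integral_mkcond.
apply: eq_integral => t _; rewrite patchE; case: ifPn => [|].
  rewrite inE/= in_itv/= andbT => t0.
  transitivity ((2^-1 * (expR (- t) / t))%:E *
    \int[@lebesgue_measure R]_(x in `[(y - t)%R, (y + t)%R]) (g x)%:E)%E.
    rewrite -ge0_integralZl_EFin//.
    - rewrite [RHS]integral_mkcond; apply: eq_integral => x _.
      rewrite patchE /k indicE/=.
      have -> : ((x, t) \in S) = (x \in `[y - t, y + t]%classic).
        by apply/idP/idP; rewrite !inE /S/= in_itv/= ler_distlC.
      by case: ifP => _; rewrite ?mulr1 ?mulr0// -EFinM mulrAC.
    - by move=> x _; rewrite lee_fin g0.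
    - by apply/measurable_EFinP; exact: measurable_funTS.
    - by rewrite !mulr_ge0 ?invr_ge0 ?expR_ge0// ltW.
  have cG := is_derive_continuous _ _ _ dG.
  rewrite (@continuous_FTC2 R g G); first last.
  - by move=> x _; rewrite derive1E derive_val.
  - split.
    + by move=> x _; exact: ex_derive.
    + by apply: cvg_at_right_filter; exact: cG.
    + by apply: cvg_at_left_filter; exact: cG.
  - exact: continuous_subspaceT.
  - lra.
  by rewrite -EFinB -EFinM; congr EFin; field; rewrite gt_eqF.
rewrite notin_setE/= in_itv/= andbT => /negP; rewrite -leNgt => t0.
apply: integral0_eq => x _; rewrite /k/= indicE.
(* At [t = 0] the integrand vanishes by the convention [0^-1 = 0]; for [t < 0] the slice of [S] is
   empty. *)
have [->|tn0] := eqVneq t 0; first by rewrite invr0 !(mulr0, mul0r).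
rewrite (_ : (x, t) \in S = false) ?mulr0//; apply/negP; rewrite inE /S/=.
have := normr_ge0 (y - x).
have : t < 0 by rewrite lt_neqAle tn0.
by move=> ? ? ?; lra.
Qed.

(** * Means over balls, the flux and its derivative *)

(* The argument is a primitive: this is the mean of [G'] over [y - t, y + t]. *)
Definition ball_mean (R : realType) (G : R -> R) (y t : R) : R :=
  (G (y + t) - G (y - t)) / (2 * t).

(* [J] of the header; its derivative is [E * g - g]. *)
Definition flux (R : realType) (G P : R -> R) (y : R) : R :=
  \int[@lebesgue_measure R]_(t in `]0, +oo[)
     (expR (- t) * (ball_mean R P y t - G y)).

Lemma ball_mean_itv (R : realType) (g G : R -> R) (m M y t : R) :
  (forall x : R, is_derive x 1 G (g x)) -> (forall x, m <= g x <= M) ->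
  0 < t -> m <= ball_mean R G y t <= M.
Proof.
move=> dG gmM t0; rewrite /ball_mean.
have [|z _ ->] := MVT_line _ _ _ (y - t) (y + t) dG; first lra.
have -> : y + t - (y - t) = 2 * t by ring.
by rewrite mulfK ?gmM//; lra.
Qed.

Lemma measurable_ball_mean (R : realType) (G : R -> R) (y : R) :
  continuous G -> measurable_fun (`]0, +oo[ : set R) (ball_mean R G y).
Proof.
move=> cG; have mG : measurable_fun setT G by exact: continuous_measurable_fun.
apply: measurable_funTS; rewrite /ball_mean; apply: measurable_funM.
  apply: measurable_funB; apply: (measurableT_comp mG).
    exact: measurable_funD.
  exact: measurable_funB.
apply: (@measurableT_comp _ _ _ _ _ _ (@GRing.inv R)); first exact: measurable_invr.
exact: measurable_funM.
Qed.

Lemma integrable_ball_mean (R : realType) (g G : R -> R) (T y : R) :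
  (forall x : R, is_derive x 1 G (g x)) -> (forall x, 0 <= g x <= T) ->
  (@lebesgue_measure R).-integrable `]0, +oo[
    (EFin \o (fun t => expR (- t) * ball_mean R G y t)).
Proof.
move=> dG gT; apply: (integrable_quadratic_expRN _ _ T).
  by apply: measurable_ball_mean; exact: is_derive_continuous dG.
move=> t t0; have /andP[b0 bT] := ball_mean_itv _ _ _ _ _ y _ dG gT t0.
by rewrite ger0_norm//; nra.
Qed.

Lemma integrable_cst_expRN (R : realType) (k : R) :
  (@lebesgue_measure R).-integrable `]0, +oo[ (EFin \o (fun t => expR (- t) * k)).
Proof.
by apply: (integrable_quadratic_expRN _ _ `|k|) => // t t0; rewrite ler_peMr//; nra.
Qed.

Lemma Rintegral_cst_expRN (R : realType) (k : R) :
  \int[@lebesgue_measure R]_(t in `]0, +oo[) (expR (- t) * k) = k.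
Proof.
have := integral_expRN R 1 ltr01; under eq_integral do rewrite mul1r.
move=> e1; rewrite RintegralZr//; first by rewrite /Rintegral e1 invr1 mul1r.
by have := integrable_cst_expRN R 1; under [fun t => _ * 1]eq_fun do rewrite mulr1.
Qed.

Lemma Rintegral_ball_mean_sub (R : realType) (g G : R -> R) (T k y : R) :
  (forall x : R, is_derive x 1 G (g x)) -> (forall x, 0 <= g x <= T) ->
  \int[@lebesgue_measure R]_(t in `]0, +oo[)
     (expR (- t) * (ball_mean R G y t - k)) =
  \int[@lebesgue_measure R]_(t in `]0, +oo[) (expR (- t) * ball_mean R G y t) - k.
Proof.
move=> dG gT; rewrite -[X in _ = _ - X](Rintegral_cst_expRN R k).
rewrite -RintegralB//; last exact: integrable_cst_expRN.
- by apply: eq_Rintegral => t _; rewrite mulrBr.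
- exact: integrable_ball_mean dG gT.
Qed.

(** [centered_mean_bound] with [K = 0] bounds the bracket by [2 * t] times a mean of [g], hence by
    [T * (2 * t) <= T * (1 + t ^+ 2)]. *)
Lemma integrable_flux (R : realType) (g G P : R -> R) (T y : R) :
  (forall x : R, is_derive x 1 G (g x)) -> (forall x : R, is_derive x 1 P (G x)) ->
  (forall x, 0 <= g x <= T) ->
  (@lebesgue_measure R).-integrable `]0, +oo[
    (EFin \o (fun t => expR (- t) * (ball_mean R P y t - G y))).
Proof.
move=> dG dP gT; apply: (integrable_quadratic_expRN _ _ T).
  apply: measurable_funB => //.
  by apply: measurable_ball_mean; exact: is_derive_continuous dP.
move=> t t0; have /andP[b0 bT] := ball_mean_itv _ _ _ _ _ y _ dG gT t0.
have g0 : (forall x, g x <= 0) \/ (forall x, 0 <= g x).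
  by right=> x; have /andP[] := gT x.
apply: le_trans (centered_mean_bound _ _ _ _ _ y _ dG dP g0 t0) _.
have -> : G (y + t) - G (y - t) = ball_mean R G y t * (2 * t).
  by rewrite /ball_mean divfK//; lra.
rewrite mul0r sub0r normrN ger0_norm; last by apply: mulr_ge0 => //; lra.
apply: (@le_trans _ _ (T * (2 * t))); first by apply: ler_wpM2r => //; lra.
apply: ler_wpM2l; first lra.
by rewrite -subr_ge0 (_ : _ - _ = (t - 1) ^+ 2) ?sqr_ge0//; ring.
Qed.

Lemma is_derive_ball_mean (R : realType) (g G : R -> R) (t x : R) :
  (forall x : R, is_derive x 1 G (g x)) ->
  is_derive x 1 (fun y => ball_mean R G y t) (ball_mean R g x t).
Proof.
move=> dG; rewrite /ball_mean.
have d1 : is_derive x 1 (fun y : R => G (y + t)) (g (x + t)).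
  have d1' : is_derive x 1 (fun y : R => y + t) 1.
    by apply: is_derive_eq; rewrite addr0.
  have := @is_derive1_comp R G (fun y => y + t) x (g (x + t)) 1 (dG _) d1'.
  by rewrite mulr1.
have d2 : is_derive x 1 (fun y : R => G (y - t)) (g (x - t)).
  have d2' : is_derive x 1 (fun y : R => y - t) 1.
    by apply: is_derive_eq; rewrite subr0.
  have := @is_derive1_comp R G (fun y => y - t) x (g (x - t)) 1 (dG _) d2'.
  by rewrite mulr1.
by apply: is_derive_eq; rewrite /GRing.scale/=; ring.
Qed.

(** Differentiation under the integral: the mean of [P] differentiates to the mean of [G]. As that
    mean and [g] both lie in [[0, T]], [expR (- t) * T] dominates uniformly in [x]. *)
Lemma is_derive_flux (R : realType) (g G P : R -> R) (T y : R) :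
  (forall x : R, is_derive x 1 G (g x)) -> (forall x : R, is_derive x 1 P (G x)) ->
  (forall x, 0 <= g x <= T) ->
  is_derive y 1 (flux R G P)
    (\int[@lebesgue_measure R]_(t in `]0, +oo[)
       (expR (- t) * (ball_mean R G y t - g y))).
Proof.
move=> dG dP gT.
pose h (x t : R) := expR (- t) * (ball_mean R P x t - G x).
have dh (x t : R) :
    is_derive x 1 (h ^~ t) (expR (- t) * (ball_mean R G x t - g x)).
  have dm := is_derive_ball_mean R G P t x dP.
  by apply: is_derive_eq; rewrite /GRing.scale/=; ring.
have d1E x t : partial1of2 h x t = expR (- t) * (ball_mean R G x t - g x).
  by rewrite partial1of2E derive_val.
have T0 : 0 <= T by have /andP[? ?] := gT 0; lra.
have Iy : `]y - 1, y + 1[%classic y by rewrite /= in_itv/=; apply/andP; split; lra.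
have ih x : `]y - 1, y + 1[%classic x ->
    (@lebesgue_measure R).-integrable `]0, +oo[ (EFin \o h x).
  by move=> _; exact: integrable_flux dG dP gT.
have dh' x t : `]y - 1, y + 1[%classic x -> `]0, +oo[%classic t ->
  derivable (h ^~ t) x 1 by move=> _ _; exact: ex_derive.
have G0 t : 0 <= expR (- t) * T by rewrite mulr_ge0// expR_ge0.
have hG x t : `]y - 1, y + 1[%classic x -> `]0, +oo[%classic t ->
    `|partial1of2 h x t| <= expR (- t) * T.
  move=> _; rewrite /= in_itv/= andbT => t0.
  rewrite d1E normrM ger0_norm ?expR_ge0//; apply: ler_wpM2l; first exact: expR_ge0.
  have /andP[? ?] := ball_mean_itv _ _ _ _ _ x _ dG gT t0.
  by have /andP[? ?] := gT x; rewrite ler_norml; apply/andP; split; lra.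
have iG := integrable_cst_expRN R T.
have mD : measurable (`]0, +oo[ : set (measurableTypeR R)) by exact: measurable_itv.
apply: DeriveDef.
  exact: (derivable_under_integral mD Iy ih dh' G0 iG hG).
rewrite -derive1E (differentiation_under_integral mD Iy ih dh' G0 iG hG).
by apply: eq_Rintegral => t _; rewrite d1E.
Qed.

(** * Smallness of the flux *)

(** [centered_mean_bound] controls the flux integrand by [2 * t] times the deviation of the mean of
    [g] from [K]. The unbounded weight [t] is traded for a constant [L] plus a second-moment
    remainder of order [1 / L], which leaves the unweighted deviation that the equation controls. *)
Lemma normr_flux_le (R : realType) (g G P : R -> R) (T K L y : R) :
  (forall x : R, is_derive x 1 G (g x)) -> (forall x : R, is_derive x 1 P (G x)) ->
  (forall x, 0 <= g x <= T) -> 0 <= K <= T ->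
  (forall x, g x <= K) \/ (forall x, K <= g x) -> 0 < L ->
  `|flux R G P y| <=
  2 * L * `|\int[@lebesgue_measure R]_(t in `]0, +oo[)
              (expR (- t) * ball_mean R G y t) - K| +
  2 * T / L * \int[@lebesgue_measure R]_(t in `]0, +oo[) (expR (- t) * t ^+ 2).
Proof.
move=> dG dP gT /andP[K0 KT] gK L0.
have mD : measurable (`]0, +oo[ : set (measurableTypeR R)) by exact: measurable_itv.
pose e t := expR (- t) * (ball_mean R G y t - K).
have ie : (@lebesgue_measure R).-integrable `]0, +oo[ (EFin \o e).
  apply: (integrable_quadratic_expRN _ _ T).
    apply: measurable_funB => //.
    by apply: measurable_ball_mean; exact: is_derive_continuous dG.
  move=> t t0; have /andP[b0 bT] := ball_mean_itv _ _ _ _ _ y _ dG gT t0.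
  have : `|ball_mean R G y t - K| <= T by rewrite ler_norml; apply/andP; split; lra.
  by move/le_trans; apply; rewrite ler_peMr//; nra.
have iq : (@lebesgue_measure R).-integrable `]0, +oo[
    (EFin \o (fun t => expR (- t) * t ^+ 2)).
  apply: (integrable_quadratic_expRN _ _ 1).
    by apply: measurable_funTS; exact: measurable_funX.
  by move=> t _; rewrite ger0_norm ?sqr_ge0//; lra.
have ine : (@lebesgue_measure R).-integrable `]0, +oo[ (EFin \o (fun t => `|e t|)).
  exact: integrable_norm ie.
rewrite -(Rintegral_ball_mean_sub _ _ _ _ _ _ dG gT) -/(e _).
(* Since [g] lies on one side of [K], so do its means; [e] has constant sign and the absolute value
   passes inside. *)
have -> : `|\int[@lebesgue_measure R]_(t in `]0, +oo[) e t| =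
    \int[@lebesgue_measure R]_(t in `]0, +oo[) `|e t|.
  have [gK'|Kg] := gK.
  - have e0 t : `]0, +oo[%classic t -> e t <= 0.
      rewrite /= in_itv/= andbT => t0; apply: mulr_ge0_le0; first exact: expR_ge0.
      have gK'' x : 0 <= g x <= K by have /andP[-> _] := gT x; rewrite gK'.
      by have /andP[] := ball_mean_itv _ _ _ _ _ y _ dG gK'' t0; lra.
    transitivity (- \int[@lebesgue_measure R]_(t in `]0, +oo[) e t).
      apply: ler0_norm; rewrite -oppr_ge0 -mulN1r -RintegralZl//.
      by apply: Rintegral_ge0 => t /e0; rewrite mulN1r oppr_ge0.
    rewrite -mulN1r -RintegralZl//; apply: eq_Rintegral => t /set_mem/e0 et.
    by rewrite mulN1r ler0_norm.
  - have e0 t : `]0, +oo[%classic t -> 0 <= e t.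
      rewrite /= in_itv/= andbT => t0; apply: mulr_ge0; first exact: expR_ge0.
      have gK'' x : K <= g x <= T by have /andP[_ ->] := gT x; rewrite Kg.
      by have /andP[] := ball_mean_itv _ _ _ _ _ y _ dG gK'' t0; lra.
    rewrite ger0_norm; last exact: Rintegral_ge0.
    by apply: eq_Rintegral => t /set_mem/e0 et; rewrite ger0_norm.
have iF := integrable_flux _ _ _ _ _ y dG dP gT.
apply: le_trans (le_normr_Rintegral mD iF) _.
rewrite -!RintegralZl// -RintegralD//.
- apply: le_Rintegral => //.
  + exact: integrable_norm iF.
  + exact: (integrableD mD (integrableZl mD (2 * L) ine)
      (integrableZl mD (2 * T / L) iq)).
  move=> t; rewrite /= in_itv/= andbT => t0.
  rewrite /e !normrM !(ger0_norm (expR_ge0 _)).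
  rewrite mulrCA [X in _ <= _ + X]mulrCA -mulrDr.
  apply: ler_wpM2l; first exact: expR_ge0.
  apply: le_trans (centered_mean_bound _ _ _ _ _ y _ dG dP gK t0) _.
  have -> : G (y + t) - G (y - t) = ball_mean R G y t * (2 * t).
    by rewrite /ball_mean divfK//; lra.
  rewrite -mulrBl normrM distrC (ger0_norm (_ : 0 <= 2 * t)); last lra.
  set b := `|_ - K|.
  have b0 : 0 <= b by exact: normr_ge0.
  have bT : b <= T.
    have /andP[? ?] := ball_mean_itv _ _ _ _ _ y _ dG gT t0.
    by rewrite /b ler_norml; apply/andP; split; lra.
  (* AM-GM: [2 t <= 2 L + 2 t^2 / L] *)
  have tL : 2 * t <= 2 * L + 2 * t ^+ 2 / L.
    rewrite -(ler_pM2r L0).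
    have -> : (2 * L + 2 * t ^+ 2 / L) * L = 2 * L ^+ 2 + 2 * t ^+ 2.
      by field; rewrite gt_eqF.
    have := sqr_ge0 (t - L); have := sqr_ge0 t; have := sqr_ge0 L; nra.
  have tT : b * (t ^+ 2 / L) <= T * (t ^+ 2 / L).
    by apply: ler_wpM2r => //; rewrite divr_ge0 ?sqr_ge0// ltW.
  have := ler_wpM2l b0 tL.
  have -> : 2 * T / L * t ^+ 2 = 2 * (T * (t ^+ 2 / L)) by ring.
  have -> : b * (2 * L + 2 * t ^+ 2 / L) = 2 * L * b + 2 * (b * (t ^+ 2 / L)) by ring.
  lra.
- exact: (integrableZl mD _ ine).
- exact: (integrableZl mD _ iq).
Qed.

Lemma Rintegral_ball_mean_itv (R : realType) (g G : R -> R) (m M T y : R) :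
  (forall x : R, is_derive x 1 G (g x)) -> (forall x, 0 <= g x <= T) ->
  (forall x, m <= g x <= M) ->
  m <= \int[@lebesgue_measure R]_(t in `]0, +oo[) (expR (- t) * ball_mean R G y t)
    <= M.
Proof.
move=> dG gT gmM.
have mD : measurable (`]0, +oo[ : set (measurableTypeR R)) by exact: measurable_itv.
have iG := integrable_ball_mean R g G T y dG gT.
apply/andP; split; [rewrite -[leLHS](Rintegral_cst_expRN R m)|
  rewrite -[leRHS](Rintegral_cst_expRN R M)];
  apply: le_Rintegral => //; try exact: integrable_cst_expRN.
all: move=> t; rewrite /= in_itv/= andbT => t0; apply: ler_wpM2l;
  by [exact: expR_ge0|have /andP[] := ball_mean_itv _ _ _ _ _ y _ dG gmM t0].
Qed.

(** * Suprema and elementary estimates *)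

Lemma ex_supremum (R : realType) (f : R -> R) (B : R) : (forall x, f x <= B) ->
  exists M, [/\ forall x, f x <= M, M <= B &
    forall d, 0 < d -> exists y, M - d < f y].
Proof.
move=> fB.
have hs : has_sup (range f).
  by split; [exists (f 0), 0|exists B => _ [x _ <-]].
exists (sup (range f)); split.
- by move=> x; apply: sup_upper_bound => //; exists x.
- by apply: ge_sup => [|_ [x _ <-]//]; exists (f 0), 0.
- by move=> d d0; have [_ [y _ <-] ?] := sup_adherent d0 hs; exists y.
Qed.

Lemma le0_of_mul_bounded (R : realType) (x C : R) :
  (forall L, 1 <= L -> x * L <= C) -> x <= 0.
Proof.
move=> xC; rewrite leNgt; apply/negP => x0.
have C0 : 0 < C by have := xC 1 (lexx _); lra.
(* This [L] gives [x * L = x + C], which exceeds [C]. *)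
have := xC (1 + C / x); rewrite mulrDr mulr1 mulrCA mulfV ?gt_eqF// mulr1.
have : 0 < C / x by rewrite divr_gt0.
move=> ? /(_ ltac:(lra)); lra.
Qed.

Lemma pow4_sub_le (R : realType) (a b d T : R) :
  0 <= a -> a <= b -> b <= T -> b - a <= d -> b ^+ 4 - a ^+ 4 <= 4 * T ^+ 3 * d.
Proof.
move=> a0 ab bT bad.
have -> : b ^+ 4 - a ^+ 4 = (b - a) * ((b + a) * (b ^+ 2 + a ^+ 2)) by ring.
have -> : 4 * T ^+ 3 * d = d * ((T + T) * (T ^+ 2 + T ^+ 2)) by ring.
have s2 z : 0 <= z -> z <= T -> z ^+ 2 <= T ^+ 2.
  by move=> z0 zT; apply: lerXn2r; rewrite ?nnegrE//; lra.
have := s2 a a0 ltac:(lra); have := s2 b ltac:(lra) bT.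
have := sqr_ge0 a; have := sqr_ge0 b => *.
by apply: ler_pM; [lra|apply: mulr_ge0; lra|lra|apply: ler_pM; lra].
Qed.

(** * From the first integral to constancy *)

(** The comparison argument freed from integrals: [F] stands for the flux, [q] for the second moment
    of [expR (- t)], and [f ^+ 4 + c * f1 - f2] for the convolution, its value by the equation. *)
Lemma first_integral_constant (R : realType) (f f1 f2 F : R -> R) (c T q : R) :
  0 < c -> 0 <= T -> 0 <= q ->
  (forall x : R, is_derive x 1 f (f1 x)) ->
  (forall x : R, is_derive x 1 f1 (f2 x)) ->
  (forall x, 0 <= f x <= T) ->
  (forall x y, f1 x - c * f x + F x = f1 y - c * f y + F y) ->
  (forall m M y, (forall x, m <= f x ^+ 4 <= M) ->
    m <= f y ^+ 4 + c * f1 y - f2 y <= M) ->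
  (forall K L y, 0 <= K <= T ^+ 4 ->
    (forall x, f x ^+ 4 <= K) \/ (forall x, K <= f x ^+ 4) -> 0 < L ->
    `|F y| <= 2 * L * `|f y ^+ 4 + c * f1 y - f2 y - K| + 2 * T ^+ 4 / L * q) ->
  exists k : R, forall y, f y = k.
Proof.
move=> c0 T0 q0 d1 d2 fI Phi_ab meanI fluxle.
have f0 x : 0 <= f x by have /andP[] := fI x.
have fT x : f x <= T by have /andP[] := fI x.
have gT x : 0 <= f x ^+ 4 <= T ^+ 4.
  by rewrite exprn_ge0//=; apply: lerXn2r; rewrite ?nnegrE.
have [M [fM MT Mf]] := ex_supremum R f T fT.
have Nf0 x : - f x <= 0 by rewrite oppr_le0.
have [m [fm m0 mf]] := ex_supremum R (fun x => - f x) 0 Nf0.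
have T40 : 0 <= T ^+ 4 by exact: exprn_ge0.
(* At [a] and [b] the convolution is within [k * d] of the extreme value of [f ^+ 4]: the three
   terms account for the fourth power, [c * f1] and [f2]. *)
pose k := 4 * T ^+ 3 + 2 * c + 2.
have k0 : 0 <= k by have : 0 <= T ^+ 3 by [exact: exprn_ge0]; rewrite /k; lra.
(* [m] is the supremum of [- f], so [M + m] is the oscillation of [f]. *)
pose C := 4 + 4 * k + 4 * (T ^+ 4) * q + 2 * c.
have MmC L : 1 <= L -> (c * (M + m)) * L <= C.
  move=> L1; have L0 : 0 < L by lra.
  (* With this [d] the errors [L * (k * d)] and [T ^+ 4 / L * q] are both of order [1 / L], so the
     total error times [L] stays below [C]. *)
  pose d := L^-1 ^+ 2.
  have d0 : 0 < d by rewrite exprn_gt0// invr_gt0.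
  have [a [fa f1a f2a]] := approximate_max _ _ _ _ _ _ d1 d2 fM d0 (Mf _ d0).
  have dN1 (x : R) : is_derive x 1 (fun x => - f x) (- f1 x) by exact: is_deriveN.
  have dN2 (x : R) : is_derive x 1 (fun x => - f1 x) (- f2 x) by exact: is_deriveN.
  have [b [fb f1b f2b]] := approximate_max _ _ _ _ _ _ dN1 dN2 fm d0 (mf _ d0).
  rewrite normrN in f1b.
  have /andP[f1a1 f1a2] : - (2 * d) <= f1 a <= 2 * d by rewrite -ler_norml.
  have /andP[f1b1 f1b2] : - (2 * d) <= f1 b <= 2 * d by rewrite -ler_norml.
  have fluxa : `|F a| <= 2 * L * (k * d) + 2 * T ^+ 4 / L * q.
    have M0 : 0 <= M by exact: le_trans (fM 0).
    have gM x : 0 <= f x ^+ 4 <= M ^+ 4.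
      by rewrite exprn_ge0//=; apply: lerXn2r; rewrite ?nnegrE.
    have MK : 0 <= M ^+ 4 <= T ^+ 4.
      by rewrite exprn_ge0//=; apply: lerXn2r; rewrite ?nnegrE.
    have gK : (forall x, f x ^+ 4 <= M ^+ 4) \/ (forall x, M ^+ 4 <= f x ^+ 4).
      by left=> x; have /andP[] := gM x.
    apply: le_trans (fluxle _ _ a MK gK L0) _.
    rewrite lerD2r; apply: ler_wpM2l; first lra.
    (* The convolution cannot exceed [M ^+ 4], so only its lower estimate remains; at [b] the roles
       are reversed. *)
    have /andP[_] := meanI _ _ a gM.
    move=> ?; rewrite ler0_norm ?subr_le0//.
    have := pow4_sub_le R (f a) M d T (f0 a) (fM a) MT ltac:(lra).
    have := ler_wpM2l (ltW c0) f1a1; rewrite /k; lra.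
  have fluxb : `|F b| <= 2 * L * (k * d) + 2 * T ^+ 4 / L * q.
    have m0' : 0 <= - m by lra.
    have fm' x : - m <= f x by have := fm x; lra.
    have gm x : (- m) ^+ 4 <= f x ^+ 4 <= T ^+ 4.
      by have /andP[_ ->] := gT x; rewrite andbT; apply: lerXn2r; rewrite ?nnegrE.
    have MK : 0 <= (- m) ^+ 4 <= T ^+ 4.
      rewrite exprn_ge0//=; apply: lerXn2r; rewrite ?nnegrE//.
      exact: le_trans (fm' 0) (fT 0).
    have gK : (forall x, f x ^+ 4 <= (- m) ^+ 4) \/ (forall x, (- m) ^+ 4 <= f x ^+ 4).
      by right=> x; have /andP[] := gm x.
    apply: le_trans (fluxle _ _ b MK gK L0) _.
    rewrite lerD2r; apply: ler_wpM2l; first lra.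
    have /andP[+ _] := meanI _ _ b gm.
    move=> ?; rewrite ger0_norm ?subr_ge0//.
    have := pow4_sub_le R (- m) (f b) d T m0' (fm' b) (fT b) ltac:(lra).
    have := ler_wpM2l (ltW c0) f1b2; rewrite /k; lra.
  have {}Phi_ab := Phi_ab a b.
  have /andP[fa1 fa2] := ltac:(move: fluxa; rewrite ler_norml; exact: id).
  have /andP[fb1 fb2] := ltac:(move: fluxb; rewrite ler_norml; exact: id).
  (* Equality of the first integral at [a] and [b] bounds [c * (f a - f b)] by the two slopes and
     two fluxes; replacing [f a] by [M] and [f b] by [- m] costs [2 * (c * d)]. *)
  have cMm : c * (M + m) <=
      4 * d + 4 * L * (k * d) + 4 * T ^+ 4 / L * q + 2 * (c * d).
    have := ler_wpM2l (ltW c0) (ltW fa); have := ler_wpM2l (ltW c0) (ltW fb); lra.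
  have dL : d * L <= 1.
    by rewrite /d expr2 -mulrA mulVf ?gt_eqF// mulr1 invf_le1.
  have dLL : d * L * L = 1 by rewrite /d; field; rewrite gt_eqF.
  apply: le_trans (ler_wpM2r (ltW L0) cMm) _.
  have -> : (4 * d + 4 * L * (k * d) + 4 * T ^+ 4 / L * q + 2 * (c * d)) * L =
    4 * (d * L) + 4 * k * (d * L * L) + 4 * T ^+ 4 * q + 2 * c * (d * L).
    by field; rewrite gt_eqF.
  have := ler_wpM2l (ltW c0) dL.
  by rewrite dLL /C mulr1; lra.
have Mm : M + m <= 0.
  by have := le0_of_mul_bounded R _ _ MmC; rewrite pmulr_rle0.
exists M => y; apply/eqP; rewrite eq_le fM/=.
by have := fm y; lra.
Qed.

(** * Application to the integro-differential equation *)

Theorem theorem3p6 (R : realType) (c lambda T_M : R) (f : R -> R) :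
  0 < c -> 0 < lambda -> lambda < T_M ->
  (forall x, derivable f x 1) ->
  (forall x, derivable (derive1 f) x 1) ->
  continuous (derive1n 2 f) ->
  (forall y, ((derive1n 2 f y - c * (derive1 f) y - f y ^+ 4)%:E = - @Econv R f y)%E) ->
  (forall y, lambda <= f y <= T_M) ->
  exists k : R, forall y, f y = k.
Proof.
move=> c0 l0 lT df ddf _ eqf fI.
pose f1 := derive1 f; pose f2 := derive1 f1.
have d1 (x : R) : is_derive x 1 f (f1 x).
  by apply: DeriveDef; [exact: df|rewrite -derive1E].
have d2 (x : R) : is_derive x 1 f1 (f2 x).
  by apply: DeriveDef; [exact: ddf|rewrite -derive1E].
have cf : continuous f by exact: is_derive_continuous d1.
pose g x := f x ^+ 4.
have cg : continuous g.
  by apply: (@is_derive_continuous R _ (fun x => 4 * f x ^+ 3 * f1 x)) => x;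
    apply: is_derive_eq; rewrite /GRing.scale/=; ring.
have [G dG] := ex_primitive R g cg.
have [P dP] := ex_primitive R G (is_derive_continuous _ _ _ dG).
have T0 : 0 <= T_M by lra.
have f0 x : 0 <= f x by have /andP[? ?] := fI x; lra.
have fT x : f x <= T_M by have /andP[? ?] := fI x.
have gT x : 0 <= g x <= T_M ^+ 4.
  by rewrite /g exprn_ge0//=; apply: lerXn2r; rewrite ?nnegrE.
have eqn y : \int[@lebesgue_measure R]_(t in `]0, +oo[)
    (expR (- t) * ball_mean R G y t) = g y + c * f1 y - f2 y.
  (* The equation itself shows that [Econv] is finite, so taking its real part loses nothing. *)
  rewrite /Rintegral -(Econv_mean R f G y cf dG) -[Econv R f y]oppeK -eqf.
  by rewrite /= -/f1 -/f2 /g; ring.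
(* The flux has derivative [c * f1 - f2] by [eqn], which cancels that of [f1 - c * f]. *)
pose Phi x := f1 x - c * f x + flux R G P x.
have Phi_cst x y : Phi x = Phi y.
  apply: is_derive_0_is_cst => {x y} x.
  have := is_derive_flux R g G P _ x dG dP gT.
  rewrite (Rintegral_ball_mean_sub _ _ _ _ _ _ dG gT) eqn => dF.
  by apply: is_derive_eq; rewrite /GRing.scale/=; ring.
have q0 : 0 <= \int[@lebesgue_measure R]_(t in `]0, +oo[) (expR (- t) * t ^+ 2).
  by apply: Rintegral_ge0 => t _; rewrite mulr_ge0 ?expR_ge0 ?sqr_ge0.
have fI0 x : 0 <= f x <= T_M by rewrite f0 fT.
apply: (first_integral_constant _ _ _ _ _ _ _ _ c0 T0 q0 d1 d2 fI0 Phi_cst).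
- move=> m M y gmM; rewrite -/(g y) -eqn.
  exact: Rintegral_ball_mean_itv dG gT gmM.
- move=> K L y KT gK L0; rewrite -/(g y) -eqn.
  exact: normr_flux_le dG dP gT KT gK L0.
Qed.
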